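(* Let $A$ and $B$ be arbitrary non-empty sets. For any set $\mathcal{T}$ of $A$-to-$B$ relational constraints, the following hold: (i) $\mathbf{CSF}(\mathbf{mFSC}(\mathcal{T}))=\mathbf{LO}(\mathbf{wCM}(\mathcal{T}\cup\{(\emptyset,\emptyset),(A,B)\}))$, (ii) $\mathbf{CSF}(\mathbf{pFSC}(\mathcal{T}))=\mathbf{LO}(\mathbf{wCM}(\mathcal{T}\cup\{(\emptyset,\emptyset),(A,B),(=_A,=_B)\}))$, (iii) $\mathbf{CSF}(\mathbf{tFSC}(\mathcal{T}))=\mathbf{LO}(\mathbf{CM}(\mathcal{T}\cup\{(\emptyset,\emptyset),(A,B)\}))$, and (iv) $\mathbf{CSF}(\mathbf{sFSC}(\mathcal{T}))=\mathbf{LO}(\mathbf{CM}(\mathcal{T}\cup\{(\emptyset,\emptyset),(=_A,=_B)\}))$.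
   Context: Conventions: $n,m,\dots$ denote positive integers, viewed as ordinals $n=\{0,\dots,n-1\}$; an $m$-tuple over $A$ is a map $m\to A$. An $m$-ary relation on $A$ is a subset of $A^m$; empty relations of different arities are regarded as distinct, and $\emptyset$ denotes the unary empty relation. $=_A$, $=_B$ are the (binary) equality relations on $A$ and $B$. Functions: an $n$-ary multivalued function on $A$ to $B$ is a map $f:A^n\to\mathcal{P}(B)$, where $\mathcal{P}(B)$ is the set of all subsets of $B$. It is total if $f(\mathbf{a})\ne\emptyset$ for all $\mathbf{a}\in A^n$; it is a partial function if each $f(\mathbf{a})$ is empty or a singleton; it is single-valued if it is both total and partial. For $\mathbf{a}^1,\dots,\mathbf{a}^n\in A^m$, let $f(\mathbf{a}^1\ldots\mathbf{a}^n)=\prod_{i\in m}f(\mathbf{a}^1(i),\dots,\mathbf{a}^n(i))\subseteq B^m$, and for $R\subseteq A^m$ let $fR=\bigcup\{f(\mathbf{a}^1\ldots\mathbf{a}^n):\mathbf{a}^1,\dots,\mathbf{a}^n\in R\}$. Constraints: an $m$-ary $A$-to-$B$ (relational) constraint is an ordered pair $(R,S)$ with $R\subseteq A^m$ and $S\subseteq B^m$; all constraints have finite arity. $f$ satisfies $(R,S)$ if $fR\subseteq S$. $\mathbf{mFSC}(\mathcal{T})$ is the class of all multivalued functions on $A$ to $B$ (of all arities) satisfying every constraint in $\mathcal{T}$; $\mathbf{pFSC}(\mathcal{T})$, $\mathbf{tFSC}(\mathcal{T})$, $\mathbf{sFSC}(\mathcal{T})$ are the classes of all partial, all total multivalued,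 and all single-valued functions in $\mathbf{mFSC}(\mathcal{T})$, respectively. For a set $\mathcal{M}$ of multivalued functions, $\mathbf{CSF}(\mathcal{M})$ is the set of all $A$-to-$B$ constraints satisfied by every function in $\mathcal{M}$. Conjunctive minors: a minor formation scheme with target $m$, indeterminate set $V$ (an arbitrary, possibly empty or infinite, set disjoint from $m$ and from all $n_j$) and source family $(n_j)_{j\in J}$ (a non-empty family of positive integers) is a family $H=(h_j)_{j\in J}$ of maps $h_j:n_j\to m\cup V$; it is simple if $V=\emptyset$. For $\mathbf{a}:m\to A$ and $\sigma:V\to A$, $\mathbf{a}+\sigma:m\cup V\to A$ is the map agreeing with $\mathbf{a}$ on $m$ and with $\sigma$ on $V$, and $(\mathbf{a}+\sigma)h_j:n_j\to A$ is its composite with $h_j$ (similarly for $B$). An $m$-ary constraint $(R,S)$ is a conjunctive minor of a non-empty family $(R_j,S_j)_{j\in J}$ of constraints, $(R_j,S_j)$ of arity $n_j$, if for some such scheme $H$, for all $\mathbf{a}\in A^m$, $\mathbf{b}\in B^m$: (a) $\mathbf{a}\in R$ implies there is $\sigma_A:V\to A$ with $(\mathbf{a}+\sigma_A)h_j\in R_j$ for all $j\in J$; and (b) if there is $\sigma_B:V\to B$ with $(\mathbf{b}+\sigma_B)h_j\in S_j$ for all $j\in J$, then $\mathbf{b}\in S$. It is a weak conjunctive minor if $H$ can be taken simple. $\mathbf{CM}(\mathcal{T})$ (resp. $\mathbf{wCM}(\mathcal{T})$) is the smallest set of $A$-to-$B$ constraints containing $\mathcal{T}$ and containing every conjunctive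 minor (resp. weak conjunctive minor) of every non-empty family of its members. Local closure: $(R',S')$ is a relaxation of $(R,S)$ (of the same arity) if $R'\subseteq R$ and $S'\supseteq S$; it is a finite relaxation if moreover $R'$ is finite. A set of constraints is locally closed if it contains every $A$-to-$B$ constraint all of whose finite relaxations belong to it. $\mathbf{LO}(\mathcal{T})$ is the smallest locally closed set of $A$-to-$B$ constraints containing $\mathcal{T}$. *)

(* Defs.v *)
From mathcomp Require Import all_boot.
From mathcomp Require Import boolp classical_sets functions cardinality.

Set Implicit Arguments.
Unset Strict Implicit.
Unset Printing Implicit Defensive.

Local Open Scope classical_set_scope.

(* Arities are positive. The arity is part of a constraint, so that pairs of
   empty relations of different arities are different constraints. *)
Record constraint (A B : Type) := Constraint {
  arity : nat;
  arity_gt0 : (0 < arity)%N;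
  antecedent : set ('I_arity -> A);
  consequent : set ('I_arity -> B) }.

Arguments antecedent {A B} c _ : rename.
Arguments consequent {A B} c _ : rename.

Definition empty_constraint (A B : Type) : constraint A B :=
  @Constraint A B 1 isT set0 set0.

Definition full_constraint (A B : Type) : constraint A B :=
  @Constraint A B 1 isT setT setT.

Definition eq_rel (X : Type) : set ('I_2 -> X) :=
  [set x | x ord0 = x ord_max].

Definition eq_constraint (A B : Type) : constraint A B :=
  @Constraint A B 2 isT (@eq_rel A) (@eq_rel B).

Record mvfun (A B : Type) := MVFun {
  fun_arity : nat;
  fun_arity_gt0 : (0 < fun_arity)%N;
  fun_val :> ('I_fun_arity -> A) -> set B }.

Arguments fun_val {A B} f a _ : rename.

Definition total (A B : Type) (f : mvfun A B) : Prop :=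
  forall a, f a !=set0.

Definition partial (A B : Type) (f : mvfun A B) : Prop :=
  forall a, f a = set0 \/ exists b, f a = [set b].

Definition single_valued (A B : Type) (f : mvfun A B) : Prop :=
  total f /\ partial f.

(* f (a^1 ... a^n) as a subset of B^m, the m-tuple a^k being [a k] *)
Definition tuple_image (A B : Type) (f : mvfun A B) (m : nat)
    (a : 'I_(fun_arity f) -> 'I_m -> A) : set ('I_m -> B) :=
  [set b | forall i, f (fun k => a k i) (b i)].

Arguments tuple_image {A B} f {m} a _.

Definition rel_image (A B : Type) (f : mvfun A B) (m : nat)
    (R : set ('I_m -> A)) : set ('I_m -> B) :=
  \bigcup_(a in [set a | forall k, R (a k)]) tuple_image f a.

Definition satisfies (A B : Type) (f : mvfun A B) (c : constraint A B) : Prop :=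
  rel_image f (antecedent c) `<=` consequent c.

Definition mFSC (A B : Type) (T : set (constraint A B)) : set (mvfun A B) :=
  [set f | forall c, T c -> satisfies f c].

Definition pFSC (A B : Type) (T : set (constraint A B)) : set (mvfun A B) :=
  [set f | mFSC T f /\ partial f].

Definition tFSC (A B : Type) (T : set (constraint A B)) : set (mvfun A B) :=
  [set f | mFSC T f /\ total f].

Definition sFSC (A B : Type) (T : set (constraint A B)) : set (mvfun A B) :=
  [set f | mFSC T f /\ single_valued f].

Definition CSF (A B : Type) (M : set (mvfun A B)) : set (constraint A B) :=
  [set c | forall f, M f -> satisfies f c].

(* a + sigma; the disjoint union of m and V is the sum type *)
Definition extend (m : nat) (V X : Type) (a : 'I_m -> X) (sigma : V -> X)
    (x : 'I_m + V) : X :=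
  match x with inl i => a i | inr v => sigma v end.

Definition minor_via (A B : Type) (c : constraint A B)
    (J : Type) (F : J -> constraint A B) (V : Type)
    (h : forall j, 'I_(arity (F j)) -> 'I_(arity c) + V) : Prop :=
  (forall a, antecedent c a -> exists sigma : V -> A,
     forall j, antecedent (F j) (extend a sigma \o h j)) /\
  (forall b, (exists sigma : V -> B,
     forall j, consequent (F j) (extend b sigma \o h j)) -> consequent c b).

Definition conjunctive_minor (A B : Type) (c : constraint A B)
    (J : Type) (F : J -> constraint A B) : Prop :=
  exists (V : Type) (h : forall j, 'I_(arity (F j)) -> 'I_(arity c) + V),
    minor_via h.

Definition weak_conjunctive_minor (A B : Type) (c : constraint A B)
    (J : Type) (F : J -> constraint A B) : Prop :=
  exists (V : Type) (h : forall j, 'I_(arity (F j)) -> 'I_(arity c) + V),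
    ~ inhabited V /\ minor_via h.

Definition CM_closed (A B : Type) (T : set (constraint A B)) : Prop :=
  forall (J : Type) (F : J -> constraint A B) (c : constraint A B),
    inhabited J -> (forall j, T (F j)) -> conjunctive_minor c F -> T c.

Definition wCM_closed (A B : Type) (T : set (constraint A B)) : Prop :=
  forall (J : Type) (F : J -> constraint A B) (c : constraint A B),
    inhabited J -> (forall j, T (F j)) -> weak_conjunctive_minor c F -> T c.

Definition CM (A B : Type) (T : set (constraint A B)) : set (constraint A B) :=
  smallest (@CM_closed A B) T.

Definition wCM (A B : Type) (T : set (constraint A B)) : set (constraint A B) :=
  smallest (@wCM_closed A B) T.

(* [relaxation c' c]: c' is a relaxation of c *)
Definition relaxation (A B : Type) (c' c : constraint A B) : Prop :=
  exists (R' : set ('I_(arity c) -> A)) (S' : set ('I_(arity c) -> B)),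
    [/\ R' `<=` antecedent c, consequent c `<=` S'
      & c' = Constraint (arity_gt0 c) R' S'].

Definition finite_relaxation (A B : Type) (c' c : constraint A B) : Prop :=
  relaxation c' c /\ finite_set (antecedent c').

Definition locally_closed (A B : Type) (T : set (constraint A B)) : Prop :=
  forall c, (forall c', finite_relaxation c' c -> T c') -> T c.

Definition LO (A B : Type) (T : set (constraint A B)) : set (constraint A B) :=
  smallest (@locally_closed A B) T.

(* Main.v *)
Require Import Defs.
From mathcomp Require Import all_boot.
From mathcomp Require Import boolp classical_sets functions cardinality.

Local Open Scope classical_set_scope.

(** Local closure reduces the matter to constraints with finite antecedent, and
    an empty antecedent gives a minor of the empty constraint. Let [c] be a
    constraint satisfied by all functions of the class, with antecedent the
    tuples [a 0, ..., a (n-1)]. It is a minor of the family of all constraints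
    of [T] placed, by maps [h] into the arity of [c] plus [V], so that they hold
    of the columns of [a]. Indeed, if a tuple [b] with values [sigma] of the
    indeterminates satisfies all the placed constraints, then the [n]-ary
    function sending the column over [y] to the value of [b + sigma] at [y]
    satisfies [T], hence [c], and so [b] is in the consequent of [c]. For
    empty [V] this is an arbitrary multivalued function; if [V] consists of all
    [n]-tuples over [A], each being its own column, it is total; and placing the
    equality constraint makes it a partial function. *)

(** * Closure properties of the constraints satisfied by a class of functions *)

Section Soundness.
Context {A B : Type}.
Implicit Types (c : constraint A B) (f : mvfun A B) (M : set (mvfun A B))
  (T : set (constraint A B)).

Lemma satisfiesP f c :
  satisfies f c <->
  forall a b, (forall k, antecedent c (a k)) -> tuple_image f a b ->
    consequent c b.
Proof.
split=> [fc a b ca fab|fc b [a ca fab]]; first by apply: fc; exists a.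
exact: fc ca fab.
Qed.

Lemma satisfies_empty f : satisfies f (empty_constraint A B).
Proof.
apply/satisfiesP => a b ca _.
exact: (ca (Ordinal (fun_arity_gt0 f))).
Qed.

Lemma satisfies_full f : satisfies f (full_constraint A B).
Proof. by []. Qed.

Lemma satisfies_eq f : partial f -> satisfies f (eq_constraint A B).
Proof.
move=> pf; apply/satisfiesP => a b ca fab.
have := fab ord0; have := fab ord_max.
have -> : (fun k => a k ord0) = (fun k => a k ord_max).
  by apply: funext => k; exact: ca.
by rewrite /= /eq_rel /=; case: (pf (fun k => a k ord_max)) => [->|[y ->]] //= -> ->.
Qed.

(** Each argument tuple [a k] has its own witness [s k]. Choosing a value of [f] on these witnesses
    at every [v] gives the witness [t] for [b]; such values exist by totality, or vacuously when [V]
    is empty. *)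
Lemma minor_satisfies f (J : Type) (F : J -> constraint A B) c (V : Type)
    (h : forall j, 'I_(arity (F j)) -> 'I_(arity c) + V) :
  Defs.total f \/ ~ inhabited V -> (forall j, satisfies f (F j)) ->
  minor_via h -> satisfies f c.
Proof.
move=> fV fF [hA hB]; apply/satisfiesP => a b ca fab.
have [s hs] := choice (fun k => hA _ (ca k)).
have /choice[t ht] (v : V) : exists y, f (fun k => s k v) y.
  case: fV => [tf|nV]; first exact: tf.
  by case: nV; exists.
apply: hB; exists t => j.
apply: (proj1 (satisfiesP f (F j)) (fF j) (fun k => extend (a k) (s k) \o h j)).
  by move=> k; exact: hs.
by move=> i /=; case: (h j i) => [i'|v] /=; [exact: fab|exact: ht].
Qed.

Lemma wCM_closed_CSF M : wCM_closed (CSF M).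
Proof.
move=> J F c _ MF [V [h [nV hmin]]] f Mf.
by apply: minor_satisfies hmin; [right|move=> j; exact: MF].
Qed.

Lemma CM_closed_CSF M : M `<=` @Defs.total A B -> CM_closed (CSF M).
Proof.
move=> Mt J F c _ MF [V [h hmin]] f Mf.
by apply: minor_satisfies hmin; [left; exact: Mt|move=> j; exact: MF].
Qed.

(** A violation by [f] involves only as many antecedent tuples as [f] has arguments, so it already
    occurs in a finite relaxation. *)
Lemma locally_closed_CSF M : locally_closed (CSF M).
Proof.
move=> c Mc f Mf; apply/satisfiesP => a b ca fab.
pose c' := Constraint (arity_gt0 c) (range a) (consequent c).
have : satisfies f c'.
  apply: Mc => //; split; last exact/finite_image/finite_finset.
  by exists (range a), (consequent c); split=> // _ [k _ <-].
by move=> /satisfiesP/(_ a b); apply=> // k; exists k.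
Qed.

Lemma CM_closed_wCM_closed T : CM_closed T -> wCM_closed T.
Proof.
move=> cT J F c Ji TF [V [h [_ hmin]]].
by apply: cT TF _ => //; exists V, h.
Qed.

Lemma CM_closed_CM T : CM_closed (CM T).
Proof.
move=> J F c Ji TF cF C CT.
by apply: (CT.1 J F) => // j; exact: TF.
Qed.

Lemma wCM_closed_wCM T : wCM_closed (wCM T).
Proof.
move=> J F c Ji TF cF C CT.
by apply: (CT.1 J F) => // j; exact: TF.
Qed.

Lemma empty_antecedent_wCM C c :
  wCM_closed C -> C (empty_constraint A B) -> antecedent c = set0 -> C c.
Proof.
move=> clC C0 c0; apply: (clC unit (fun=> empty_constraint A B)) => //.
(* Any coordinate would do: no tuple meets the empty consequent, so the second minor condition is
   vacuous. *)
exists False, (fun _ _ => inl (Ordinal (arity_gt0 c))); split; first by case.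
by split=> [a|b [_ /(_ tt)]] //; rewrite c0.
Qed.

End Soundness.

(** * Functions read off from the columns of a finite antecedent *)

Section Completeness.
Context {A B : Type}.
Implicit Types (c : constraint A B) (T : set (constraint A B)).

Lemma finite_set_range {X : Type} {R : set X} :
  finite_set R -> R !=set0 ->
  exists (n : nat) (a : 'I_n -> X), (0 < n)%N /\ R = range a.
Proof.
move=> /finite_setP[n Rn] R0.
have [f _] := finite_set_bij (proj2 (set0P R) R0) Rn (@sub0set _ R).
have Rf : R = range (fun i : 'I_n => f i).
  apply/seteqP; split=> [x /(@surj _ _ _ _ f)[i ltin <-]|_ [i _ <-]].
    by exists (Ordinal ltin).
  exact: (@funS _ _ _ _ f _ (ltn_ord i)).
exists n, (fun i : 'I_n => f i); split=> //.
by move: R0; rewrite Rf => -[_ [i _ _]]; exact: leq_ltn_trans (ltn_ord i).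
Qed.

Section Columns.
Context {m n : nat} {V : Type} (n_gt0 : (0 < n)%N).
Context (a : 'I_n -> 'I_m -> A) (s : 'I_n -> V -> A).

Definition column (y : 'I_m + V) : 'I_n -> A := fun k => extend (a k) (s k) y.

(** Positions sharing a column all contribute their values; an argument that is not a column gets
    the empty set. *)
Definition column_fun (b : 'I_m -> B) (t : V -> B) : mvfun A B :=
  MVFun n_gt0 (fun x => [set extend b t y | y in [set y | column y = x]]).

Definition placement {c} (h : 'I_(arity c) -> 'I_m + V) : Prop :=
  forall k, antecedent c (extend (a k) (s k) \o h).

(** Each coordinate of a tuple [d] in the image comes from some position; collecting these positions
    gives a placement [h] through which [d] factors. *)
Lemma column_fun_satisfies c b t :
  (forall h, placement h -> consequent c (extend b t \o h)) ->
  satisfies (column_fun b t) c.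
Proof.
move=> bt; apply/satisfiesP => r d cr rd.
have /choice[h hrd] i :
    exists y, column y = (fun k => r k i) /\ extend b t y = d i.
  by have [y yr yd] := rd i; exists y.
have [hr hd] := all_and2 hrd.
have -> : d = extend b t \o h by apply: funext => i; rewrite /= hd.
apply: bt => k.
suff -> : extend (a k) (s k) \o h = r k by [].
by apply: funext => i; have /(congr1 (@^~ k)) := hr i.
Qed.

Lemma column_fun_partial b t :
  (forall h, @placement (eq_constraint A B) h -> eq_rel (extend b t \o h)) ->
  partial (column_fun b t).
Proof.
move=> bt x; have [[y xy]|nx] := pselect (exists y, column y = x); last first.
  by left; rewrite -subset0 => d [y xy _]; apply: nx; exists y.
right; exists (extend b t y); apply/seteqP; split=> [d [z zx <-]|d ->] /=.
  (* Two positions with the same column form a placement of the equality constraint. *)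
  pose h (i : 'I_2) := if i == ord0 then z else y.
  by apply: (bt h) => k; have /(congr1 (@^~ k)) := etrans zx (esym xy).
by exists y.
Qed.

End Columns.

(** The family is indexed by all pairs of a member of [T] and a placement of it. The constraint
    [c1], containing all constant tuples, makes it non-empty, as any constant map places it. *)
Lemma range_antecedent_minor {T c} {n : nat} (n_gt0 : (0 < n)%N)
    {a : 'I_n -> 'I_(arity c) -> A} {V : Type} (s : 'I_n -> V -> A) :
  antecedent c = range a ->
  (exists2 c1, T c1 & forall x, antecedent c1 (fun=> x)) ->
  (forall b t,
     (forall c1 (h : 'I_(arity c1) -> 'I_(arity c) + V), T c1 -> placement a s h ->
        consequent c1 (extend b t \o h)) ->
     satisfies (column_fun n_gt0 a s b t) c) ->
  exists (J : Type) (F : J -> constraint A B)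
      (h : forall j, 'I_(arity (F j)) -> 'I_(arity c) + V),
    [/\ inhabited J, forall j, T (F j) & minor_via h].
Proof.
move=> ca [c1 Tc1 c1x] Tc.
pose J := {p : {c1 : constraint A B & 'I_(arity c1) -> 'I_(arity c) + V} |
            T (projT1 p) /\ placement a s (projT2 p)}.
exists J, (fun j => projT1 (sval j)), (fun j => projT2 (sval j)).
split; [|by move=> j; exact: (svalP j).1|split].
- pose h (_ : 'I_(arity c1)) : 'I_(arity c) + V := inl (Ordinal (arity_gt0 c)).
  by constructor; exists (existT _ c1 h); split=> // k; exact: c1x.
- by move=> x; rewrite ca => -[k _ <-]; exists (s k) => j; exact: (svalP j).2.
- move=> b [t bt]; have /satisfiesP sat : satisfies (column_fun n_gt0 a s b t) c.
    apply: Tc => c2 h Tc2 hp.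
    exact: (bt (exist _ (existT (fun c1 => _ -> _) c2 h) (conj Tc2 hp))).
  apply: (sat a) => [k|i]; first by rewrite ca; exists k.
  by exists (inl i).
Qed.

(* [V n] is the set of indeterminates used when the antecedent is enumerated by
   ['I_n]. *)
Lemma CSF_sub_LO (C : set (constraint A B)) (M : set (mvfun A B))
    (V : nat -> Type) (s : forall n, 'I_n -> V n -> A) :
  wCM_closed C -> C (empty_constraint A B) ->
  (forall n (J : Type) (F : J -> constraint A B) c
      (h : forall j, 'I_(arity (F j)) -> 'I_(arity c) + V n),
     inhabited J -> (forall j, C (F j)) -> minor_via h -> C c) ->
  (exists2 c, C c & forall x, antecedent c (fun=> x)) ->
  (forall m n (n_gt0 : (0 < n)%N) (a : 'I_n -> 'I_m -> A) b t,
     (forall c (h : 'I_(arity c) -> 'I_m + V n), C c -> placement a (s n) h ->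
        consequent c (extend b t \o h)) ->
     M (column_fun n_gt0 a (s n) b t)) ->
  CSF M `<=` LO C.
Proof.
move=> clC C0 clV Cx hM c Mc D [clD CD]; apply: clD => c' [rel fin]; apply: CD.
have Mc' : CSF M c'.
  case: rel => R' [S' [RR SS ->]] f Mf; apply/satisfiesP => a b R'a fab.
  apply: SS; apply: (proj1 (satisfiesP f c) (Mc f Mf)) fab => k.
  exact/RR/R'a.
have [c'0|/set0P ne] := eqVneq (antecedent c') set0.
  exact: empty_antecedent_wCM c'0.
have [n [a [n_gt0 ca]]] := finite_set_range fin ne.
have [b t bt|J [F [h [Ji CF hmin]]]] :=
  range_antecedent_minor n_gt0 (s n) ca Cx; first by apply: Mc'; exact: hM.
exact: clV hmin.
Qed.

End Completeness.

(** * The two closure theorems and their four instances *)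

Section Closures.
Context {A B : Type}.
Implicit Types (T : set (constraint A B)) (M : set (mvfun A B)).

Lemma LO_sub_CSF M T : T `<=` CSF M -> LO T `<=` CSF M.
Proof. exact: smallest_sub (locally_closed_CSF M). Qed.

Lemma CSF_LO_wCM M T :
  T `<=` CSF M -> T (empty_constraint A B) -> T (full_constraint A B) ->
  (forall m n (n_gt0 : (0 < n)%N) (a : 'I_n -> 'I_m -> A) b t,
     let s _ (v : False) : A := match v with end in
     (forall c (h : 'I_(arity c) -> 'I_m + _), T c -> placement a s h ->
        consequent c (extend b t \o h)) ->
     M (column_fun n_gt0 a s b t)) ->
  CSF M = LO (wCM T).
Proof.
move=> TM T0 T1 hM; have sT : T `<=` wCM T by exact: sub_gen_smallest.
apply/seteqP; split.
  apply: (@CSF_sub_LO _ _ _ _ (fun=> False) (fun _ _ v => match v with end)).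
  - exact: wCM_closed_wCM.
  - exact: sT.
  - move=> n J F c h Ji CF hmin; apply: wCM_closed_wCM CF _ => //.
    by exists False, h; split=> //; case.
  - by exists (full_constraint A B) => //; exact: sT.
  (* Respecting all placements of constraints in the closure includes respecting those from [T]. *)
  - by move=> m n n_gt0 a b t bt; apply: hM => c h /sT; exact: bt.
by apply: LO_sub_CSF; apply: smallest_sub TM; exact: wCM_closed_CSF.
Qed.

Lemma CSF_LO_CM M T :
  M `<=` @Defs.total A B ->
  T `<=` CSF M -> T (empty_constraint A B) ->
  (exists2 c, T c & forall x, antecedent c (fun=> x)) ->
  (forall m n (n_gt0 : (0 < n)%N) (a : 'I_n -> 'I_m -> A) b t,
     let s k (v : 'I_n -> A) := v k in
     (forall c (h : 'I_(arity c) -> 'I_m + _), T c -> placement a s h ->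
        consequent c (extend b t \o h)) ->
     M (column_fun n_gt0 a s b t)) ->
  CSF M = LO (CM T).
Proof.
move=> Mt TM T0 [c1 Tc1 c1x] hM.
have sT : T `<=` CM T by exact: sub_gen_smallest.
apply/seteqP; split.
  apply: (@CSF_sub_LO _ _ _ _ (fun n => 'I_n -> A) (fun _ k v => v k)).
  - by apply: CM_closed_wCM_closed; exact: CM_closed_CM.
  - exact: sT.
  - move=> n J F c h Ji CF hmin; apply: CM_closed_CM CF _ => //.
    by exists ('I_n -> A), h.
  - by exists c1 => //; exact: sT.
  - by move=> m n n_gt0 a b t bt; apply: hM => c h /sT; exact: bt.
by apply: LO_sub_CSF; apply: smallest_sub TM; exact: CM_closed_CSF.
Qed.

Lemma column_fun_total (m n : nat) (n_gt0 : (0 < n)%N) (a : 'I_n -> 'I_m -> A)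
    (b : 'I_m -> B) t :
  Defs.total (column_fun n_gt0 a (fun k v => v k) b t).
(* The indeterminate [x] has column [x]. *)
Proof. by move=> x; exists (t x), (inr x). Qed.

End Closures.

Theorem proposition4 (A B : Type) (hA : inhabited A) (hB : inhabited B)
    (T : set (constraint A B)) :
  [/\ CSF (mFSC T) =
        LO (wCM (T `|` [set empty_constraint A B; full_constraint A B])),
      CSF (pFSC T) =
        LO (wCM (T `|` [set empty_constraint A B; full_constraint A B;
                            eq_constraint A B])),
      CSF (tFSC T) =
        LO (CM (T `|` [set empty_constraint A B; full_constraint A B]))
    & CSF (sFSC T) =
        LO (CM (T `|` [set empty_constraint A B; eq_constraint A B]))].
Proof.
split.
- apply: CSF_LO_wCM; [|by right; left|by right; right|].
  + move=> c [Tc f Tf|[->|->] f _]; [exact: Tf|exact: satisfies_empty|].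
    exact: satisfies_full.
  + move=> m n n_gt0 a b t s bt c Tc; apply: column_fun_satisfies => h.
    by apply: bt; left.
- apply: CSF_LO_wCM; [|by right; left; left|by right; left; right|].
  + move=> c [Tc f [Tf _]|[[->|->]|->] f [_ pf]].
    * exact: Tf.
    * exact: satisfies_empty.
    * exact: satisfies_full.
    * exact: satisfies_eq.
  + move=> m n n_gt0 a b t s bt; split=> [c Tc|].
      by apply: column_fun_satisfies => h; apply: bt; left.
    by apply: column_fun_partial => h; apply: bt; right; right.
- apply: CSF_LO_CM; [by move=> f []| |by right; left| |].
  + move=> c [Tc f [Tf _]|[->|->] f _]; [exact: Tf|exact: satisfies_empty|].
    exact: satisfies_full.
  + by exists (full_constraint A B) => //; right; right.
  + move=> m n n_gt0 a b t s bt; split=> [c Tc|]; last exact: column_fun_total.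
    by apply: column_fun_satisfies => h; apply: bt; left.
- apply: CSF_LO_CM; [by move=> f [_ []]| |by right; left| |].
  + move=> c [Tc f [Tf _]|[->|->] f [_ [_ pf]]].
    * exact: Tf.
    * exact: satisfies_empty.
    * exact: satisfies_eq.
  (* Constant pairs satisfy equality, so this constraint takes over the role of the full one. *)
  + by exists (eq_constraint A B) => //; right; right.
  + move=> m n n_gt0 a b t s bt; split=> [c Tc|].
      by apply: column_fun_satisfies => h; apply: bt; left.
    split; first exact: column_fun_total.
    by apply: column_fun_partial => h; apply: bt; right; right.
Qed.
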